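(* Let $p,k\geq 0$ be integers with $2p+k\ge 3$, and let $\mathfrak{g}$ be a real Lie algebra of dimension $2p+k$ which is in the null cone under an $O(p,p+k)$-action. Then $\mathfrak{g}$ has a nilpotent subalgebra of dimension $p+k$.
   Context: All Lie algebras are real and finite-dimensional. Given a non-degenerate symmetric bilinear form $g$ of signature $(p,q)$ on a real vector space $V$ of dimension $p+q$, the group $O(p,q)$ of linear isometries of $(V,g)$ acts on $\mathcal{V}:=V\otimes\wedge^2V^*$ (skew-symmetric bilinear maps $V\times V\to V$) by $(A\cdot\mu)(X,Y)=A^{-1}(\mu(AX,AY))$. The null cone is $$\mathcal{N}=\{\mu\in\mathcal{V}:\ \mu\text{ satisfies the Jacobi identity and } 0\in\overline{O(p,q)\cdot\mu}\},$$ where the closure of the orbit is taken in the usual topology of the finite-dimensional real vector space $\mathcal{V}$. A Lie algebra $\mathfrak{g}$ with bracket $\mu$ is in the null cone under an $O(p,q)$-action if, for some non-degenerate symmetric bilinear form $g$ of signature $(p,q)$ on the underlying vector space $V$ of $\mathfrak{g}$, one has $\mu\in\mathcal{N}$. Here $q=p+k$. *)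

(* Defs.v *)
From HB Require Import structures.
From mathcomp Require Import all_boot all_order all_algebra sesquilinear.
From mathcomp Require Import boolp classical_sets reals topology normedtype.

Set Implicit Arguments.
Unset Strict Implicit.
Unset Printing Implicit Defensive.

Import Order.TTheory GRing.Theory Num.Theory.
Import numFieldNormedType.Exports.

Local Open Scope classical_set_scope.
Local Open Scope ring_scope.

(* The library puts no topology on a vectType: the usual topology of a
   finite-dimensional real vector space is the one transported from the space
   of coordinates in a basis (and does not depend on the basis). *)
Definition vect_closure (R : realType) (W : vectType R) (S : set W) : set W :=
  passmx.rVof (vbasis {:W}) @^-1`
    closure [set passmx.rVof (vbasis {:W}) w | w in S].

Section LieBracket.
Variables (R : realType) (V : vectType R).
Implicit Types (mu : 'Hom(V, 'Hom(V, V))) (U W : {vspace V}).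

(* The space V (x) /\^2 V^* is the linear subspace of 'Hom(V, 'Hom(V, V)) cut
   out by skew_bracket; it is closed and has the induced topology, so closures
   can be computed in the ambient space. *)
Definition skew_bracket mu : Prop := forall x y, mu x y = - mu y x.

Definition jacobi mu : Prop :=
  forall x y z, mu x (mu y z) + mu y (mu z x) + mu z (mu x y) = 0.

Definition lie_bracket mu : Prop := skew_bracket mu /\ jacobi mu.

Definition subalgebra mu U : Prop := {in U &, forall x y, mu x y \in U}.

Definition lie_prod mu U W : {vspace V} :=
  <<[seq mu x y | x <- vbasis U, y <- vbasis W]>>%VS.

Lemma lie_prodP mu U W (Z : {vspace V}) :
  reflect {in U & W, forall x y, mu x y \in Z} (lie_prod mu U W <= Z)%VS.
Proof.
apply: (iffP span_subvP) => [sZ x y Ux Wy | UWZ _ /allpairsP[[x y] /= [Ux Wy ->]]].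
  rewrite (coord_vbasis Ux) (linear_sum mu) sum_lfunE.
  apply: rpred_sum => i _; rewrite linearZ scale_lfunE rpredZ //.
  rewrite (coord_vbasis Wy) linear_sum; apply: rpred_sum => j _.
  rewrite linearZ rpredZ //; apply: sZ.
  by apply: allpairs_f; rewrite mem_nth ?size_tuple.
by apply: UWZ; apply: vbasis_mem.
Qed.

Definition lower_central mu U (n : nat) : {vspace V} := iter n (lie_prod mu U) U.

Definition nilpotent_alg mu U : Prop := exists n, lower_central mu U n = 0%VS.

Definition bracket_act (A : 'End(V)) mu : 'Hom(V, 'Hom(V, V)) :=
  linfun (fun x => (A^-1 \o mu (A x) \o A)%VF).

Lemma bracket_actE A mu x y : bracket_act A mu x y = (A^-1)%VF (mu (A x) (A y)).
Proof.
have lin : linear (fun x => (A^-1 \o mu (A x) \o A)%VF).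
  move=> a u v; apply/lfunP => z.
  by rewrite !(comp_lfunE, add_lfunE, scale_lfunE) !linearP add_lfunE scale_lfunE linearP.
pose L : {linear V -> 'Hom(V, V)} :=
  HB.pack (fun x => (A^-1 \o mu (A x) \o A)%VF)
    (GRing.isLinear.Build _ _ _ _ _ lin).
by rewrite /bracket_act (lfunE L) !comp_lfunE.
Qed.

Implicit Types g : {symmetric V}.

Definition has_signature (p q : nat) g : Prop :=
  exists2 e : (p + q).-tuple V, basis_of fullv e &
    forall i j : 'I_(p + q),
      g (tnth e i) (tnth e j) = if i == j then (-1) ^+ (p <= i)%N else 0.

(* The elements of the orthogonal group of g are the A : 'End(V) with
   [isometry g g A]; for non-degenerate g they are automatically invertible. *)
Lemma isometry_lker0 g (A : 'End(V)) :
  nondegenerate g -> isometry g g A -> lker A == 0%VS.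
Proof.
move=> /eqP g0 gA; rewrite -subv0 -g0; apply/subvP => x; rewrite memv_ker => /eqP Ax.
by apply/mem_orthovP => y _; rewrite -gA Ax linear0l.
Qed.

Definition isometry_orbit g mu : set 'Hom(V, 'Hom(V, V)) :=
  [set bracket_act A mu | A in [set A : 'End(V) | isometry g g A]].

Definition null_cone g : set 'Hom(V, 'Hom(V, V)) :=
  [set mu | [/\ skew_bracket mu, jacobi mu &
                vect_closure (isometry_orbit g mu) 0]].

Definition in_null_cone (p q : nat) mu : Prop :=
  exists g, [/\ nondegenerate g, has_signature p q g & null_cone g mu].

End LieBracket.

(* Main.v *)
(* If the orbit of mu accumulates at 0, pick isometries A with A.mu small.  The
   singular value decomposition of A in a basis adapted to the form gives two
   Euclidean-orthonormal frames u, v with A v_i = d_i u_i, so that the structure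
   constants of A.mu in the frame v are (d_i d_j / d_k) c_ij^k, where c are those
   of mu in the frame u.  By compactness of the orthogonal group the frames u
   have a limit, and there the nonzero structure constants satisfy
   d_i d_j < d_k.  This replaces the Hilbert-Mumford criterion.
   The u_i with d_i < 1 span a totally isotropic subspace, so there are at most
   p of them; the p + k vectors u_i with the largest d_i thus have d_i >= 1, and
   since [u_i, u_j] only involves u_k with d_k > max(d_i, d_j) they span a
   nilpotent subalgebra. *)
From HB Require Import structures.
Require Import Defs.
From mathcomp Require Import all_boot all_order all_algebra sesquilinear.
From mathcomp Require Import boolp classical_sets reals topology normedtype.
From mathcomp Require Import ring lra complex.

Set Implicit Arguments.
Unset Strict Implicit.
Unset Printing Implicit Defensive.

Import Order.TTheory GRing.Theory Num.Theory.
Import numFieldNormedType.Exports.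

Local Open Scope ring_scope.

(** * Spectral theorem for real symmetric matrices *)

Section Spectral.
Variable R : rcfType.

Lemma rowmul_trE n (x y : 'rV[R]_n) : (x *m y^T) 0 0 = \sum_i x 0 i * y 0 i.
Proof. by rewrite mxE; apply: eq_bigr => i _; rewrite mxE. Qed.

Lemma rowmul_trC n (x y : 'rV[R]_n) : x *m y^T = y *m x^T.
Proof. by rewrite -[LHS]trmxK trmx_mul trmxK [LHS]mx11_scalar mxE -mx11_scalar. Qed.

Lemma rownorm_ge0 n (x : 'rV[R]_n) : 0 <= (x *m x^T) 0 0.
Proof. by rewrite rowmul_trE sumr_ge0 // => i _; rewrite -expr2 sqr_ge0. Qed.

Lemma rownorm_eq0 n (x : 'rV[R]_n) : ((x *m x^T) 0 0 == 0) = (x == 0).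
Proof.
apply/idP/eqP => [|->]; last by rewrite mul0mx mxE.
rewrite rowmul_trE psumr_eq0 => [|i _]; last by rewrite -expr2 sqr_ge0.
move=> /allP x0; apply/rowP => i; have := x0 i (mem_index_enum i).
by rewrite -expr2 sqrf_eq0 mxE => /eqP.
Qed.



Lemma orthogonal_entry_le1 n (M : 'M[R]_n) i j : M *m M^T = 1%:M -> `|M i j| <= 1.
Proof.
move=> /matrixP/(_ i i); rewrite !mxE eqxx mulr1n.
under eq_bigr do rewrite mxE -expr2.
move=> sM; rewrite -sqrtr_sqr -sqrtr1 ler_wsqrtr // -sM (bigD1 j) //= lerDl.
by rewrite sumr_ge0 // => k _; rewrite sqr_ge0.
Qed.

(** A complex eigenvector [v = x + i y] exists by algebraic closure. Symmetry makes its eigenvalue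
    real, so whichever of [x], [y] is nonzero is a real eigenvector. *)
Lemma symmetric_eigenvector n (Q : 'M[R]_n) : (0 < n)%N -> Q^T = Q ->
  exists (a : R) (x : 'rV[R]_n), x != 0 /\ x *m Q = a *: x.
Proof.
move=> n_gt0 Qsym.
pose C : numClosedFieldType := complex.complex R.
have [b /eigenvalueP[v vQ v0]] :=
  eigenvalue_closed (map_mx (complex.real_complex R) Q : 'M[C]_n) n_gt0.
pose x := map_mx (@complex.Re R) v; pose y := map_mx (@complex.Im R) v.
have ReD : {morph @complex.Re R : z w / z + w >-> z + w} by case=> ? ? [].
have ImD : {morph @complex.Im R : z w / z + w >-> z + w} by case=> ? ? [].
have xQ : x *m Q = complex.Re b *: x - complex.Im b *: y.
  apply/rowP => i; have /rowP/(_ i)/(congr1 (@complex.Re R)) := vQ.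
  rewrite !mxE (big_morph _ ReD (erefl : complex.Re 0 = 0)).
  under eq_bigr do rewrite !mxE; move=> E.
  transitivity (complex.Re (b * v 0 i)); last by case: (b) (v 0 i) => [? ?] [? ?].
  rewrite -E; apply: eq_bigr => j _; rewrite !mxE.
  by case: (v 0 j) => ? ? /=; rewrite mulr0 subr0.
have yQ : y *m Q = complex.Re b *: y + complex.Im b *: x.
  apply/rowP => i; have /rowP/(_ i)/(congr1 (@complex.Im R)) := vQ.
  rewrite !mxE (big_morph _ ImD (erefl : complex.Im 0 = 0)).
  under eq_bigr do rewrite !mxE; move=> E.
  transitivity (complex.Im (b * v 0 i)); last by case: (b) (v 0 i) => [? ?] [? ?].
  rewrite -E; apply: eq_bigr => j _; rewrite !mxE.
  by case: (v 0 j) => ? ? /=; rewrite mulr0 add0r.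
have Qxy : x *m Q *m y^T = y *m Q *m x^T.
  by rewrite rowmul_trC trmx_mul Qsym mulmxA.
(* Expanding both sides of [Qxy] leaves [Im b * (|x|^2 + |y|^2) = 0], and the second factor vanishes
   only if [v = 0]. *)
have b0 : complex.Im b = 0.
  have {}Qxy : complex.Im b * ((x *m x^T) 0 0 + (y *m y^T) 0 0) = 0.
    move: Qxy; rewrite xQ yQ mulmxBl mulmxDl -!scalemxAl (rowmul_trC y x).
    move: (x *m x^T) (y *m y^T) (x *m y^T) => X Y Z /matrixP/(_ 0 0).
    by rewrite !mxE; lra.
  apply/eqP; move/eqP: Qxy; rewrite mulf_eq0 => /orP[// | ].
  rewrite paddr_eq0 ?rownorm_ge0 // !rownorm_eq0 => /andP[/eqP x0 /eqP y0].
  case/eqP: v0; apply/rowP => i; move/rowP/(_ i): x0; move/rowP/(_ i): y0.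
  by rewrite !mxE; case: (v 0 i) => ? ? /= -> ->.
move: xQ yQ; rewrite b0 !scale0r subr0 addr0 => xQ yQ; exists (complex.Re b).
have [x0|] := eqVneq x 0; last by exists x.
exists y; split=> //; apply: contraNneq v0 => y0.
apply/eqP/rowP => i; move/rowP/(_ i): x0; move/rowP/(_ i): y0.
by rewrite !mxE; case: (v 0 i) => ? ? /= -> ->.
Qed.

(* Householder reflection in the hyperplane orthogonal to u - v. *)
Lemma orthogonal_move n (u v : 'rV[R]_n) : u *m u^T = v *m v^T ->
  exists2 H : 'M[R]_n, H *m H^T = 1%:M & u *m H = v.
Proof.
move=> uv; have [->|neq_uv] := eqVneq u v.
  by exists 1%:M; rewrite ?trmx1 ?mulmx1.
have [w Ew] : exists w, w = u - v by exists (u - v).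
pose c := (w *m w^T) 0 0.
have c0 : c != 0 by rewrite rownorm_eq0 Ew subr_eq0.
have wE : w *m w^T = c%:M by rewrite [LHS]mx11_scalar.
exists (1%:M - (2 / c) *: (w^T *m w)).
  have -> : (1%:M - (2 / c) *: (w^T *m w))^T = 1%:M - (2 / c) *: (w^T *m w).
    by rewrite linearB linearZ /= trmx1 trmx_mul trmxK.
  rewrite mulmxBl mul1mx mulmxBr mulmx1 -scalemxAl -scalemxAr scalerA.
  rewrite mulmxA -(mulmxA w^T) wE mul_mx_scalar -scalemxAl scalerA.
  rewrite -addrA -opprD -scalerBl.
  have -> : 2 / c * (2 / c) * c = 2 / c + 2 / c by field.
  by rewrite -scalerDl addrA subrr scale0r subr0.
rewrite mulmxBr mulmx1 -scalemxAr mulmxA.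
have -> : u *m w^T = (c / 2)%:M.
  rewrite [LHS]mx11_scalar; congr (_%:M); apply/esym.
  rewrite /c Ew [(u - v)^T]linearB /= !mulmxBl !mulmxBr -uv (rowmul_trC v u).
  move: (u *m u^T) (u *m v^T) => X Y; rewrite !mxE.
  by field.
rewrite mul_scalar_mx scalerA (_ : 2 / c * (c / 2) = 1); last by field.
by rewrite scale1r Ew opprB addrC subrK.
Qed.

(** Induction on [n]: rotate an eigenvector onto the first axis and diagonalize the remaining block.
    The rows of [M] are the eigenvectors. *)
Lemma symmetric_diagonalization n (Q : 'M[R]_n) : Q^T = Q ->
  exists (M : 'M[R]_n) (s : 'rV[R]_n),
    M *m M^T = 1%:M /\ M *m Q = diag_mx s *m M.
Proof.
elim: n Q => [|n IHn] Q Qsym.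
  by exists 1%:M, 0; split; apply/matrixP => -[].
have [a [x [x0 xQ]]] := symmetric_eigenvector (ltn0Sn n) Qsym.
pose c := (x *m x^T) 0 0.
have c_gt0 : 0 < c by rewrite lt0r rownorm_eq0 x0 rownorm_ge0.
pose e : 'rV[R]_n.+1 := delta_mx 0 0.
have [H HH eH] : exists2 H : 'M[R]_n.+1, H *m H^T = 1%:M &
    e *m H = (Num.sqrt c)^-1 *: x.
  apply: orthogonal_move; rewrite linearZ /= -scalemxAl -scalemxAr scalerA.
  rewrite [x *m _]mx11_scalar -/c scale_scalar_mx -invfM -expr2.
  rewrite sqr_sqrtr ?ltW // mulVf ?gt_eqF //.
  by rewrite trmx_delta mul_delta_mx [LHS]mx11_scalar mxE.
have HTH := mulmx1C HH.
pose Q' : 'M_(1 + n) := H *m Q *m H^T.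
have Q'sym : Q'^T = Q' by rewrite /Q' !trmx_mul trmxK Qsym mulmxA.
have eQ' : e *m Q' = a *: e.
  rewrite /Q' !mulmxA eH -scalemxAl xQ scalerA mulrC -scalerA -eH.
  by rewrite -!scalemxAl -mulmxA HH mulmx1.
(* [eQ'] gives the first row of [Q']; symmetry then clears the first column. *)
have Q'E : Q' = block_mx a%:M 0 0 (drsubmx Q').
  have Q'0 j : Q' 0 j = a * (j == 0)%:R.
    by move/rowP/(_ j): eQ'; rewrite -rowE !mxE.
  have ur0 : ursubmx Q' = 0.
    by apply/matrixP => i j; rewrite ord1 2!mxE lshift0 Q'0 mulr0 mxE.
  rewrite -[LHS]submxK ur0 -[dlsubmx Q']trmxK trmx_dlsub Q'sym ur0 trmx0.
  congr block_mx; apply/matrixP => i j.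
  by rewrite !ord1 2![LHS]mxE [RHS]mxE !lshift0 Q'0 mulr1.
have [|M [s [MM MQ]]] := IHn (drsubmx Q').
  by rewrite trmx_drsub Q'sym.
pose B : 'M_(1 + n) := block_mx 1%:M 0 0 M.
have BB : B *m B^T = 1%:M.
  rewrite /B tr_block_mx !trmx0 trmx1 mulmx_block.
  by rewrite !mulmx0 !mul0mx !mulmx1 !addr0 !add0r MM -scalar_mx_block.
have BQ : B *m Q' = diag_mx (row_mx a%:M s) *m B.
  rewrite Q'E /B diag_mx_row !mulmx_block.
  rewrite !mulmx0 !mul0mx !mul1mx !mulmx1 !addr0 !add0r MQ; congr block_mx.
  by apply/matrixP => i j; rewrite !ord1 !mxE.
exists (B *m H), (row_mx a%:M s); split.
  by rewrite trmx_mul mulmxA -(mulmxA B) HH mulmx1.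
by rewrite mulmxA -BQ /Q' -!mulmxA HTH mulmx1.
Qed.
End Spectral.

(** * Singular values of pseudo-orthogonal matrices *)

Section PseudoOrthogonal.
Variables (R : rcfType) (p q : nat).

Definition signature_mx : 'M[R]_(p + q) := block_mx 1%:M 0 0 (- 1%:M).
Local Notation J := signature_mx.

Lemma signature_mxE i j :
  J i j = if i == j then (-1) ^+ (p <= i)%N else 0.
Proof.
rewrite /J -(splitK i) -(splitK j).
case: (split i) => i'; case: (split j) => j' /=.
- by rewrite block_mxEul mxE (inj_eq (@lshift_inj _ _)) leqNgt ltn_ord; case: eqP.
- by rewrite block_mxEur mxE eq_lrshift.
- by rewrite block_mxEdl mxE eq_rlshift.
- rewrite block_mxEdr !mxE (inj_eq (@rshift_inj _ _)) leq_addr expr1.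
  by case: eqP; rewrite // oppr0.
Qed.

Lemma tr_signature_mx : J^T = J.
Proof. by rewrite /J tr_block_mx !trmx0 trmx1 linearN /= trmx1. Qed.

Lemma signature_mxK : J *m J = 1%:M.
Proof.
rewrite /J mulmx_block !mulmx0 !mul0mx !mulmx1 !addr0 !add0r mulmxN mulNmx.
by rewrite mulmx1 opprK -scalar_mx_block.
Qed.

(** Projection to the [p] positive coordinates is injective on a totally isotropic space: on its
    kernel the form is minus the Euclidean norm squared, so an isotropic vector there is zero. *)
Lemma isotropic_rank m (W : 'M[R]_(m, p + q)) :
  row_free W -> W *m J *m W^T = 0 -> (m <= p)%N.
Proof.
move=> freeW W0; suff : row_free (lsubmx W).
  by rewrite -row_leq_rank => /leq_trans; apply; exact: rank_leq_col.
apply: inj_row_free => v vl0.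
have : v *m W *m J *m (v *m W)^T = 0.
  by rewrite trmx_mul !mulmxA -(mulmxA v) -(mulmxA v) W0 mulmx0 mul0mx.
rewrite -[v *m W]hsubmxK /J mul_row_block tr_row_mx mul_row_col.
rewrite !mulmx0 !mulmx1 mulmxN mulmx1 addr0 add0r.
have -> : lsubmx (v *m W) = 0 by rewrite -vl0 -mulmx_lsub.
rewrite mul0mx add0r mulNmx => /eqP; rewrite oppr_eq0 => /eqP r0.
apply: (row_free_inj freeW); rewrite mul0mx -[LHS]hsubmxK.
rewrite -[lsubmx _]mulmx_lsub vl0.
have /eqP -> : rsubmx (v *m W) == 0 by rewrite -rownorm_eq0 r0 mxE.
by rewrite row_mx0.
Qed.

(** [M] diagonalizes [Q = A^T A] and the [d] are the square roots of its eigenvalues. As [Q]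
    preserves [J] too, eigenvectors with eigenvalues below 1 span an isotropic space. *)
Lemma pseudo_orthogonal_svd (A : 'M[R]_(p + q)) : A *m J *m A^T = J ->
  exists (M N : 'M[R]_(p + q)) (d : 'rV[R]_(p + q)),
    [/\ M *m M^T = 1%:M, N *m N^T = 1%:M, N *m A = diag_mx d *m M,
        forall i, 0 < d 0 i & (#|[set i | (d 0 i < 1)%R]| <= p)%N].
Proof.
move=> AJ.
have AinvE : A *m (J *m A^T *m J) = 1%:M by rewrite !mulmxA AJ signature_mxK.
(* The right inverse [J A^T J] of [A] is also a left inverse, so [A^T] is pseudo-orthogonal as
   well. *)
have ATJ : A^T *m J *m A = J.
  have := mulmx1C AinvE => /(congr1 (mulmx J)).
  by rewrite mulmx1 !mulmxA signature_mxK mul1mx.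
pose Q := A^T *m A.
have Qsym : Q^T = Q by rewrite trmx_mul trmxK.
have QJQ : Q *m J *m Q = J.
  by rewrite /Q -!mulmxA (mulmxA J) (mulmxA A) (mulmxA A) AJ mulmxA ATJ.
have [M [s [MM MQ]]] := symmetric_diagonalization Qsym.
have MQM : (M *m A^T) *m (M *m A^T)^T = diag_mx s.
  by rewrite trmx_mul trmxK mulmxA -(mulmxA M) -/Q MQ -mulmxA MM mulmx1.
have s_gt0 i : 0 < s 0 i.
  have -> : s 0 i = (row i (M *m A^T) *m (row i (M *m A^T))^T) 0 0.
    by rewrite !rowEsub trmx_mxsub -mxsub_mul MQM !mxE eqxx.
  rewrite lt0r rownorm_ge0 andbT rownorm_eq0; apply/eqP.
  (* [J A J] inverts [A^T], so a vanishing row of [M A^T] would make row [i] of [M M^T = 1]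
     vanish. *)
  move/(congr1 (mulmx^~ (J *m A *m J *m M^T))).
  have AtJ : A^T *m (J *m A *m J) = 1%:M.
    have := mulmx1C AinvE; move/(congr1 trmx).
    by rewrite !trmx_mul trmxK trmx1 tr_signature_mx !mulmxA.
  rewrite mul0mx -row_mul -mulmxA (mulmxA A^T) AtJ mul1mx MM.
  by move/rowP/(_ i)/eqP; rewrite !mxE eqxx oner_eq0.
pose d : 'rV[R]_(p + q) := \row_i Num.sqrt (s 0 i).
have d_gt0 i : 0 < d 0 i by rewrite mxE sqrtr_gt0.
have d2 i : d 0 i * d 0 i = s 0 i by rewrite -expr2 mxE sqr_sqrtr ?ltW.
pose e : 'rV[R]_(p + q) := \row_i (d 0 i)^-1.
have es : diag_mx e *m diag_mx s = diag_mx d.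
  rewrite mulmx_diag; congr diag_mx; apply/rowP => i.
  by rewrite [LHS]mxE [e 0 i]mxE -d2 mulKf ?gt_eqF.
have de : diag_mx d *m diag_mx e = 1%:M.
  rewrite mulmx_diag -diag_const_mx; congr diag_mx; apply/rowP => i.
  by rewrite [LHS]mxE [e 0 i]mxE [RHS]mxE mulfV ?gt_eqF.
(* The rows of [M A^T] are orthogonal of lengths [d i]; dividing by these lengths gives the second
   frame. *)
exists M, (diag_mx e *m M *m A^T), d; split=> //.
- rewrite !trmx_mul trmxK tr_diag_mx !mulmxA.
  rewrite -(mulmxA _ A^T) -/Q -(mulmxA _ M Q) MQ mulmxA es.
  by rewrite -(mulmxA _ M) MM mulmx1 de.
- by rewrite -(mulmxA _ A^T) -/Q -(mulmxA _ M) MQ mulmxA es.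
pose f (i : 'I_(#|[set i | (d 0 i < 1)%R]|)) : 'I_(p + q) := enum_val i.
apply: (@isotropic_rank _ (rowsub f M)).
  apply/row_freeP; exists (rowsub f M)^T.
  rewrite trmx_mxsub -mxsub_mul MM; apply/matrixP => i j.
  by rewrite !mxE (inj_eq enum_val_inj).
have QMT : Q *m M^T = M^T *m diag_mx s.
  by rewrite -[LHS]trmxK trmx_mul trmxK Qsym MQ trmx_mul tr_diag_mx.
(* Entrywise, [G = M J M^T] satisfies [G i j = s i * s j * G i j], so [G i j = 0] as soon as
   [s i * s j < 1]. *)
have GE : M *m J *m M^T = diag_mx s *m (M *m J *m M^T) *m diag_mx s.
  rewrite -{1}QJQ; move: Q MQ QMT {Qsym QJQ} => Q' MQ QMT.
  by rewrite !mulmxA MQ -!mulmxA QMT.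
rewrite mul_rowsub_mx trmx_mxsub -mxsub_mul; apply/matrixP => i j.
have s_lt1 k : 0 <= s 0 (f k) < 1.
  have := enum_valP k; rewrite inE -/(f k) => dk.
  rewrite ltW //= -d2; apply: mulr_ilt1 => //; exact: ltW.
have := congr1 (fun X : 'M_(p + q) => X (f i) (f j)) GE.
rewrite mul_mx_diag mul_diag_mx; move: (M *m J *m M^T) => G; rewrite !mxE => Gij.
have /andP[? ?] := s_lt1 i; have /andP[? ?] := s_lt1 j.
have : s 0 (f i) * s 0 (f j) < 1 by exact: mulr_ilt1.
move=> sij; have : (1 - s 0 (f i) * s 0 (f j)) * G (f i) (f j) = 0.
  by rewrite mulrBl mul1r {1}Gij; ring.
by move/eqP; rewrite mulf_eq0 subr_eq0 gt_eqF //= => /eqP.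
Qed.
End PseudoOrthogonal.

(** * Compactness of the orthogonal group and limits of frames *)

Section FrameCompactness.
Variables (R : realType) (n : nat).

(** For orthogonal [M], the structure constants in the frame given by its rows. The upper index is
    also transformed by [M], its own inverse transpose, which keeps the formula polynomial in
    [M]. *)
Definition structure_coef (c : 'I_n -> 'I_n -> 'I_n -> R) (M : 'M[R]_n) i j k :=
  \sum_a \sum_b \sum_l M i a * M j b * M k l * c a b l.

Lemma structure_coef_le c (N : 'M[R]_n) (e : R) i j k : N *m N^T = 1%:M ->
  (forall a b l, `|c a b l| <= e) -> `|structure_coef c N i j k| <= e *+ n ^ 3.
Proof.
move=> NN c_le.
have N_le1 a b : `|N a b| <= 1 by exact: orthogonal_entry_le1.
have sum_le (f : 'I_n -> R) b : (forall a, `|f a| <= b) -> `|\sum_a f a| <= b *+ n.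
  move=> fb; apply: le_trans (ler_norm_sum _ _ _) _.
  by rewrite -[leRHS](_ : \sum_(a < n) b = _) ?ler_sum // sumr_const card_ord.
rewrite !expnS expn0 muln1 !mulrnA; do 3 apply: (sum_le) => ?.
rewrite !normrM -[leRHS]mul1r ler_pM ?mulr_ge0 //.
by rewrite !mulr_ile1 ?mulr_ge0.
Qed.

Lemma vec_mx_continuous i j :
  continuous (fun r : 'rV[R]_(n * n) => (vec_mx r : 'M_n) i j).
Proof.
under eq_fun do rewrite mxE; exact: coord_continuous.
Qed.

Lemma structure_coef_continuous c i j k :
  continuous (fun r : 'rV[R]_(n * n) => structure_coef c (vec_mx r) i j k).
Proof.
do 3 (apply: continuous_big => [|? _]; first exact: add_continuous).
move=> r; have h a b := @vec_mx_continuous a b r.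
exact: (cvgMr_tmp (cvgM (cvgM (h _ _) (h _ _)) (h _ _))).
Qed.

(** A subset of the cube with side [[-1, 1]], closed because it is cut out by polynomial equations
    in the entries. *)
Lemma orthogonal_compact :
  compact [set r : 'rV[R]_(n * n) | vec_mx r *m (vec_mx r)^T = 1%:M]%classic.
Proof.
have box : compact [set r : 'rV[R]_(n * n) | forall i, `[-1, 1]%classic (r ord0 i)].
  by apply: (@rV_compact R _ (fun=> `[-1, 1]%classic)) => _; exact: segment_compact.
apply: (subclosed_compact _ box).
- have -> : [set r : 'rV[R]_(n * n) | vec_mx r *m (vec_mx r)^T = 1%:M]%classic =
    (\bigcap_(ij in [set: 'I_n * 'I_n])
      (fun r : 'rV[R]_(n * n) =>
         \sum_k (vec_mx r : 'M_n) ij.1 k * (vec_mx r : 'M_n) ij.2 k)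
      @^-1` [set (ij.1 == ij.2)%:R])%classic.
    apply/seteqP; split=> r.
      move=> /= rr [i j] _ /=; have /matrixP/(_ i j) := rr.
      rewrite [RHS]mxE => <-; rewrite [RHS]mxE.
      by apply: eq_bigr => k _; rewrite [_^T _ _]mxE.
    move=> rr; apply/matrixP => i j;
      rewrite [RHS]mxE -(rr (i, j) I) [LHS]mxE /=.
    by apply: eq_bigr => k _; rewrite [_^T _ _]mxE.
  apply: closed_bigI => ij _; apply: closed_comp => [r _|]; last exact: closed_eq.
  apply: continuous_big => [|k _]; first exact: add_continuous.
  by move=> r'; exact: (cvgM (@vec_mx_continuous _ _ r') (@vec_mx_continuous _ _ r')).
move=> r /= rr i; case/mxvec_indexP: i => i j.
by have := orthogonal_entry_le1 i j rr; rewrite in_itv /= -ler_norml mxE.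
Qed.

(** By contradiction: a frame that is not good has a neighbourhood without small pairs for all small
    [e], and compactness makes [e] uniform. Only the frame is moved to a limit point; [d] is kept
    from a nearby frame, so [P] need not be closed. *)
Lemma degenerating_frame c (P : 'rV[R]_n -> Prop) :
  (forall d, P d -> forall i, 0 < d 0 i) ->
  (forall e, 0 < e -> exists (M : 'M[R]_n) (d : 'rV[R]_n),
     [/\ M *m M^T = 1%:M, P d & forall i j k,
       `|d 0 i * d 0 j * structure_coef c M i j k| <= e * d 0 k]) ->
  exists (M : 'M[R]_n) (d : 'rV[R]_n),
    [/\ M *m M^T = 1%:M, P d & forall i j k,
       structure_coef c M i j k != 0 -> d 0 i * d 0 j < d 0 k].
Proof.
move=> Ppos smallP; apply: contrapT => nogood.
pose small e (r : 'rV[R]_(n * n)) (d : 'rV[R]_n) := forall i j k,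
  `|d 0 i * d 0 j * structure_coef c (vec_mx r) i j k| <= e * d 0 k.
have /compact_near_coveringP cover := orthogonal_compact.
have near0 : \forall e \near (0 : R)^'+%classic,
    ([set r : 'rV[R]_(n * n) | vec_mx r *m (vec_mx r)^T = 1%:M] `<=`
     [set r | ~ exists2 d, P d & small e r d])%classic.
  apply: cover => r rr.
  (* A coefficient nonzero at [r] stays above half its absolute value nearby, hence above small [e].
     Packing the indices into one finite type lets [filter_forall] treat all of them together. *)
  have near1 (ijk : 'I_n * 'I_n * 'I_n) : \forall r' \near r & e \near (0 : R)^'+%classic,
      structure_coef c (vec_mx r) ijk.1.1 ijk.1.2 ijk.2 != 0 ->
      0 < e < `|structure_coef c (vec_mx r') ijk.1.1 ijk.1.2 ijk.2|.
    case: ijk => [[i j] k] /=; set s := structure_coef c (vec_mx r) i j k.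
    have [s0|s_neq0] := eqVneq s 0.
      by exists (setT, setT) => [|? ?]; first by split; exact: filterT.
    have s_gt0 : 0 < `|s| / 2 by rewrite divr_gt0 ?normr_gt0.
    exists ([set r' | `|s| / 2 < `|structure_coef c (vec_mx r') i j k|]%classic,
            [set e | 0 < e < `|s| / 2]%classic) => [|[r' e] /= [s1 /andP[e0 e1]] _].
      split=> /=.
        have /cvgr_norm_gt := @structure_coef_continuous c i j k r; apply.
        by rewrite ltr_pdivrMr // ltr_pMr ?normr_gt0 // ltr1n.
      near=> e; apply/andP; split; near: e; first exact: nbhs_right_gt.
      exact: nbhs_right_lt.
    by rewrite e0 (lt_trans e1).
  apply: filterS (filter_forall _ near1) => -[r' e] /= re [d Pd dsmall]; apply: nogood.
  exists (vec_mx r), d; split=> // i j k c0.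
  have /andP[/= e_gt0 s2] := re (i, j, k) c0; have d_gt0 := Ppos d Pd.
  have := dsmall i j k; rewrite normrM gtr0_norm ?mulr_gt0 // => s1.
  have s_gt0 : 0 < `|structure_coef c (vec_mx r') i j k|.
    exact: lt_trans s2.
  (* With [s'] the coefficient at [r']: [d i * d j * |s'| <= e * d k < |s'| * d k]; cancel
     [|s'|]. *)
  rewrite -(ltr_pM2r s_gt0) (le_lt_trans s1) // mulrC.
  by rewrite ltr_pM2l.
have [e [notsmall e_gt0]] := filter_ex (filterI near0 (nbhs_right_gt (0 : R))).
have [M [d [MM Pd dsmall]]] := smallP e e_gt0.
case: (notsmall (mxvec M)); first by rewrite /= mxvecK.
by exists d => // i j k; rewrite mxvecK.
Unshelve. all: end_near.
Qed.
End FrameCompactness.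

(** * Upper sets of weights and coordinate subspaces *)

Lemma upper_set_card (R : realDomainType) n (d : 'I_n -> R) (b : R) m :
  (m <= #|[set i | (b <= d i)%R]|)%N ->
  exists I : {set 'I_n}, [/\ #|I| = m, {in I, forall i, b <= d i} &
    {in I, forall i j, d i < d j -> j \in I}].
Proof.
move=> le_m.
(* Starting from all [i] with [b <= d i], remove a minimum of [d] [t] times. An index strictly above
   a remaining one is never the removed minimum, so ties are harmless. *)
suff ind t : (t <= #|[set i | (b <= d i)%R]| - m)%N -> exists I : {set 'I_n},
    [/\ #|I| = (#|[set i | (b <= d i)%R]| - t)%N, {in I, forall i, b <= d i} &
    {in I, forall i j, d i < d j -> j \in I}].
  by have [I [cI ? ?]] := ind _ (leqnn _); exists I; rewrite cI subKn.
elim: t => [_|t IHt lt_t].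
  exists [set i | b <= d i]; rewrite subn0; split=> // i; rewrite ?inE // => bi j ij.
  by rewrite inE (le_trans bi) ?ltW.
have [I [cI bI upI]] := IHt (ltnW lt_t).
have /card_gt0P[i1 Ii1] : (0 < #|I|)%N.
  by rewrite cI subn_gt0 (leq_trans lt_t) ?leq_subr.
pose i0 := [arg min_(i < i1 in I) d i]%O.
have [Ii0 min_i0] : i0 \in I /\ {in I, forall i, d i0 <= d i}.
  by rewrite /i0; case: arg_minP.
exists (I :\ i0); split.
- by have := cardsD1 i0 I; rewrite Ii0 cI subnS => ->.
- by move=> i /setD1P[_ /bI].
- move=> i /setD1P[_ Ii] j ij; rewrite in_setD1 (upI i) // andbT.
  by apply: contraTneq ij => ->; rewrite -leNgt min_i0.
Qed.

Section CoordinateSubspace.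
Variables (K : fieldType) (V : vectType K) (n : nat) (u : n.-tuple V).
Hypothesis u_basis : basis_of fullv u.

Definition coord_subspace (I : {set 'I_n}) : {vspace V} :=
  <<[seq tnth u i | i in I]>>%VS.

Lemma dim_coord_subspace (I : {set 'I_n}) : \dim (coord_subspace I) = #|I|.
Proof.
have /catl_free : free ([seq tnth u i | i in I] ++ [seq tnth u i | i in ~: I]).
  rewrite -map_cat; rewrite (@perm_free _ _ _ u) ?(basis_free u_basis) //.
  rewrite -[X in perm_eq _ X]map_tnth_enum perm_map //.
  apply: uniq_perm; rewrite ?cat_uniq ?enum_uniq //=.
    rewrite andbT; apply/hasPn => i; rewrite !mem_enum inE //.
  by move=> i; rewrite mem_cat !mem_enum inE orbN.
by move/eqP; rewrite size_map -cardE.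
Qed.

Lemma mem_coord_subspace (I : {set 'I_n}) x :
  (forall k, coord u k x != 0 -> k \in I) -> x \in coord_subspace I.
Proof.
move=> xI; rewrite (coord_basis u_basis (memvf x)).
apply: rpred_sum => k _; have [->|/xI kI] := eqVneq (coord u k x) 0.
  by rewrite scale0r mem0v.
by rewrite rpredZ // -tnth_nth memv_span // fintype.image_f.
Qed.

Lemma coord_subspaceS (I J : {set 'I_n}) :
  I \subset J -> (coord_subspace I <= coord_subspace J)%VS.
Proof.
move=> /fintype.subsetP IJ; apply: sub_span => _ /fintype.imageP[i Ii ->].
by rewrite fintype.image_f ?IJ.
Qed.

End CoordinateSubspace.

(** * Nilpotency from strictly increasing weights *)

Section Weights.
Variables (R : realType) (V : vectType R) (mu : 'Hom(V, 'Hom(V, V))).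

Lemma lie_prodS (U U' W W' : {vspace V}) : (U <= U')%VS -> (W <= W')%VS ->
  (lie_prod mu U W <= lie_prod mu U' W')%VS.
Proof.
move=> /subvP UU' /subvP WW'; apply/lie_prodP => x y xU yW.
by have /lie_prodP := subvv (lie_prod mu U' W'); apply; [apply: UU'|apply: WW'].
Qed.

Lemma lie_prod_span (X Y : seq V) (Z : {vspace V}) :
  {in X & Y, forall x y, mu x y \in Z} -> (lie_prod mu <<X>> <<Y>> <= Z)%VS.
Proof.
move=> XYZ; apply/lie_prodP => x y /(@coord_span _ _ _ (in_tuple X)) ->.
move=> /(@coord_span _ _ _ (in_tuple Y)) ->.
rewrite (linear_sum mu) sum_lfunE; apply: rpred_sum => i _.
rewrite linearZ scale_lfunE rpredZ // linear_sum; apply: rpred_sum => j _.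
by rewrite linearZ rpredZ // XYZ // mem_nth.
Qed.

Lemma nilpotent_subalgebra_of_weights n (u : n.-tuple V) (d : 'I_n -> R) m :
  basis_of fullv u -> (forall i, 0 < d i) ->
  (forall i j k, coord u k (mu (tnth u i) (tnth u j)) != 0 -> d i * d j < d k) ->
  (m <= #|[set i | (1 <= d i)%R]|)%N ->
  exists U : {vspace V}, [/\ subalgebra mu U, nilpotent_alg mu U & \dim U = m].
Proof.
move=> u_basis d_gt0 weight /upper_set_card[I [cardI I_ge1 upI]].
(* Counting the lighter elements of [I] turns the real weights on [I] into integers below [#|I|], so
   the filtration [L] vanishes at [#|I|]. *)
pose rank i := #|[set l in I | (d l < d i)%R]|.
pose L t := coord_subspace u [set i in I | (t <= rank i)%N].
have L0 : L 0%N = coord_subspace u I.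
  by congr coord_subspace; apply/setP => i; rewrite inE leq0n andbT.
have step t : (lie_prod mu (coord_subspace u I) (L t) <= L t.+1)%VS.
  apply: lie_prod_span => _ _ /fintype.imageP[i Ii ->] /fintype.imageP[j + ->].
  rewrite inE => /andP[Ij tj]; apply: (mem_coord_subspace u_basis) => k /weight.
  (* Since [d i >= 1], [d j <= d i * d j < d k]. Then [k] is in the upper set [I], and [j] itself
     witnesses that its rank grows. *)
  move=> ijk; have {ijk} jk : d j < d k.
    by apply: le_lt_trans ijk; rewrite ler_peMl ?I_ge1 ?ltW.
  rewrite inE (upI j) //= (leq_ltn_trans tj) //.
  apply/proper_card/fintype.properP; split.
    by apply/fintype.subsetP => l; rewrite !inE => /andP[-> /lt_trans->].
  by exists j; rewrite !inE Ij ?jk // ltxx.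
exists (coord_subspace u I); split; last by rewrite dim_coord_subspace.
- apply/lie_prodP; rewrite -{2}L0; apply: subv_trans (step 0%N) _.
  by apply: coord_subspaceS; apply/fintype.subsetP => i; rewrite !inE => /andP[].
exists #|I|; apply/eqP; rewrite -subv0.
have <- : L #|I| = 0%VS.
  rewrite /L [X in coord_subspace u X](_ : _ = finset.set0).
    by rewrite /coord_subspace /image_mem enum_set0 span_nil.
  apply/setP => i; rewrite !inE; apply/negP => /andP[Ii]; rewrite leqNgt => /negP[].
  apply/proper_card/fintype.properP; split.
    by apply/fintype.subsetP => l; rewrite inE => /andP[].
  by exists i; rewrite // inE Ii ltxx.
(* Term [t] of the lower central series lies in [L t]. *)
elim: #|I| => [|t IHt]; first by rewrite L0.
exact: subv_trans (lie_prodS (subvv _) IHt) (step t).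
Qed.
End Weights.

(** * Orthogonal frames relative to a basis *)

Section Frame.
Variables (R : realType) (V : vectType R) (n : nat) (e : n.-tuple V).
Hypothesis e_basis : basis_of fullv e.

Definition frame (M : 'M[R]_n) : n.-tuple V :=
  [tuple \sum_a M i a *: tnth e a | i < n].

Lemma coord_frame M i l : coord e l (tnth (frame M) i) = M i l.
Proof.
rewrite tnth_mktuple; under eq_bigr do rewrite (tnth_nth 0).
by rewrite coord_sum_free // (basis_free e_basis).
Qed.

(** Comparing [e]-coordinates reduces this to [M^T M = 1]: the coordinates in an orthogonal frame
    are Euclidean inner products with its rows. *)
Lemma frame_expansion M z : M *m M^T = 1%:M ->
  z = \sum_k (\sum_l coord e l z * M k l) *: tnth (frame M) k.
Proof.
move=> /mulmx1C MTM; set w := \sum_k _.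
rewrite (coord_basis e_basis (memvf z)) (coord_basis e_basis (memvf w)).
apply: eq_bigr => a _; congr (_ *: _); rewrite linear_sum.
under eq_bigr do rewrite linearZ /= coord_frame mulr_suml.
rewrite exchange_big (bigD1 a) //= [X in _ + X]big1 ?addr0 => [|l l_a].
  under eq_bigr do rewrite -mulrA; rewrite -mulr_sumr.
  have /matrixP/(_ a a) := MTM; rewrite !mxE eqxx.
  by under eq_bigr do rewrite mxE; move=> ->; rewrite mulr1.
under eq_bigr do rewrite -mulrA; rewrite -mulr_sumr.
have /matrixP/(_ l a) := MTM; rewrite !mxE (negPf l_a).
by under eq_bigr do rewrite mxE; move=> ->; rewrite mulr0.
Qed.

Lemma frame_basis M : M *m M^T = 1%:M -> basis_of fullv (frame M).
Proof.
move=> MM; rewrite basisEdim size_tuple (size_basis e_basis) leqnn andbT.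
apply/subvP => z _; rewrite (frame_expansion z MM).
by apply: rpred_sum => k _; rewrite rpredZ // memv_span // mem_tnth.
Qed.

Lemma coord_orthogonal_frame M k z : M *m M^T = 1%:M ->
  coord (frame M) k z = \sum_l coord e l z * M k l.
Proof.
move=> MM; rewrite {1}(frame_expansion z MM).
under [in LHS]eq_bigr do rewrite (tnth_nth 0).
by rewrite coord_sum_free // (basis_free (frame_basis MM)).
Qed.

Variable mu : 'Hom(V, 'Hom(V, V)).

Definition basis_coef a b l := coord e l (mu (tnth e a) (tnth e b)).

Lemma structure_coefE M i j k : M *m M^T = 1%:M ->
  structure_coef basis_coef M i j k =
    coord (frame M) k (mu (tnth (frame M) i) (tnth (frame M) j)).
Proof.
move=> MM; rewrite coord_orthogonal_frame //.
under [RHS]eq_bigr do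
  rewrite [tnth (frame M) i]tnth_mktuple [tnth (frame M) j]tnth_mktuple.
rewrite /structure_coef.
under [LHS]eq_bigr do rewrite exchange_big; rewrite exchange_big /=; apply: eq_bigr => l _.
rewrite (linear_sum mu) sum_lfunE linear_sum mulr_suml; apply: eq_bigr => a _.
rewrite linearZ scale_lfunE linearZ !linear_sum /= mulr_sumr mulr_suml.
apply: eq_bigr => b _; rewrite !linearZ /basis_coef /=. 
by ring.
Qed.
End Frame.

(** * From the orbit closure to small structure constants *)

Lemma vect_closure0_small (R : realType) (W : vectType R) (I : finType)
    (f : I -> W -> R) (S : set W) (e : R) :
  (forall i, scalar (f i)) -> vect_closure S 0 -> 0 < e ->
  exists2 w, S w & forall i, `|f i w| <= e.
Proof.
move=> f_lin S0 e_gt0.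
pose F i : {scalar W} := HB.pack (f i) (GRing.isLinear.Build _ _ _ _ _ (f_lin i)).
pose b := vbasis {:W}.
(* [C] bounds every [f i] against the sup norm of coordinates; the [+ 1] keeps it positive. *)
pose C : R := \sum_i \sum_j `|f i (tnth b j)| + 1.
have C_gt0 : 0 < C by rewrite ltr_wpDl // sumr_ge0 // => i _; rewrite sumr_ge0.
have /S0 [] : nbhs (passmx.rVof b 0) (ball (passmx.rVof b 0) (e / C)).
  by apply: nbhsx_ballx; rewrite divr_gt0.
move=> _ [[w Sw <-] [_ wball]]; exists w => // i.
have {}wball j : `|coord b j w| <= e / C.
  by have := wball 0 j; rewrite !mxE linear0 -ball_normE /ball_ /= sub0r normrN => /ltW.
rewrite -[f i]/(F i : W -> R) [w](coord_basis (vbasisP _) (memvf w)) linear_sum.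
apply: le_trans (ler_norm_sum _ _ _) _.
apply: (@le_trans _ _ (\sum_j e / C * `|f i (tnth b j)|)).
  apply: ler_sum => j _; rewrite linearZ /= normrM -tnth_nth.
  by rewrite ler_wpM2r.
rewrite -mulr_sumr mulrAC ler_pdivrMr // ler_pM2l //.
rewrite /C (bigD1 i) //= -addrA lerDl addr_ge0 // sumr_ge0 // => k _.
by rewrite sumr_ge0.
Qed.

Section Action.
Variables (R : realType) (V : vectType R) (mu : 'Hom(V, 'Hom(V, V))).

Lemma frame_image n (e : n.-tuple V) (A : 'End(V)) (M N : 'M[R]_n) d :
  basis_of fullv e ->
  N *m (\matrix_(i, j) coord e j (A (tnth e i))) = diag_mx d *m M ->
  forall i, A (tnth (frame e N) i) = d 0 i *: tnth (frame e M) i.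
Proof.
move=> e_basis NA i; rewrite !tnth_mktuple linear_sum scaler_sumr.
under eq_bigr => a _ do
  rewrite linearZ /= (coord_basis e_basis (memvf (A (tnth e a)))) scaler_sumr.
rewrite exchange_big; apply: eq_bigr => j _.
under eq_bigr do rewrite -tnth_nth scalerA; rewrite -scaler_suml scalerA.
congr (_ *: _); have /matrixP/(_ i j) := NA; rewrite mul_diag_mx !mxE => <-.
by apply: eq_bigr => a _; rewrite !mxE.
Qed.

(** With [A v_i = d_i u_i], bilinearity produces [d_i * d_j], and [A] multiplies the [k]-th frame
    coordinate by [d_k]. Keeping [d_k] on the right avoids a division. *)
Lemma structure_coef_act n (e : n.-tuple V) (A : 'End(V)) (M N : 'M[R]_n) d i j k :
  basis_of fullv e -> lker A == 0%VS -> M *m M^T = 1%:M -> N *m N^T = 1%:M ->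
  N *m (\matrix_(i, j) coord e j (A (tnth e i))) = diag_mx d *m M ->
  d 0 i * d 0 j * structure_coef (basis_coef e mu) M i j k =
  structure_coef (basis_coef e (bracket_act A mu)) N i j k * d 0 k.
Proof.
move=> e_basis A0 MM NN NA; rewrite !structure_coefE // bracket_actE.
have Av := frame_image e_basis NA.
rewrite !Av; set v := frame e N; set u := frame e M.
pose z := mu (d 0 i *: tnth u i) (d 0 j *: tnth u j); rewrite -/z.
have zE : z = (d 0 i * d 0 j) *: mu (tnth u i) (tnth u j).
  by rewrite /z linearZ linearZ /= scale_lfunE scalerA mulrC.
have -> : d 0 i * d 0 j * coord u k (mu (tnth u i) (tnth u j)) = coord u k z.
  by rewrite zE linearZ.
set y := (A^-1)%VF z.
have <- : A y = z by rewrite /y lker0_lfunVK.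
have v_basis : basis_of fullv v by exact: frame_basis.
have Avy a : A (coord v a y *: tnth v a) = (coord v a y * d 0 a) *: tnth u a.
  by rewrite linearZ /= Av scalerA.
have -> : A y = \sum_a (coord v a y * d 0 a) *: u`_a.
  rewrite {1}(coord_basis v_basis (memvf y)) linear_sum.
  by apply: eq_bigr => a _; rewrite -!tnth_nth; exact: Avy.
by rewrite coord_sum_free // (basis_free (frame_basis e_basis MM)).
Qed.

End Action.

Lemma isometry_signature_mx (R : realType) (V : vectType R) p q (g : {symmetric V})
    (e : (p + q).-tuple V) (A : 'End(V)) :
  basis_of fullv e ->
  (forall i j, g (tnth e i) (tnth e j) = if i == j then (-1) ^+ (p <= i)%N else 0) ->
  isometry g g A ->
  let M := \matrix_(i, j) coord e j (A (tnth e i)) in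
  M *m signature_mx R p q *m M^T = signature_mx R p q.
Proof.
move=> e_basis ge gA M; apply/matrixP => i j.
rewrite signature_mxE -ge -gA.
rewrite (coord_basis e_basis (memvf (A (tnth e i)))).
rewrite (coord_basis e_basis (memvf (A (tnth e j)))).
rewrite [LHS]mxE linear_sumr /=; apply: eq_bigr => b _.
rewrite linear_sumlz [(M *m _) i b]mxE mulr_suml; apply: eq_bigr => a _.
rewrite linearZl_LR linearZr_LR /= -!tnth_nth ge -signature_mxE.
by rewrite [M^T b j]mxE ![M _ _]mxE; ring.
Qed.

Theorem corollary7p2 (R : realType) (p k : nat) (V : vectType R)
    (mu : 'Hom(V, 'Hom(V, V)))
    (hpk : (3 <= 2 * p + k)%N)
    (hdim : \dim (@fullv R V) = (2 * p + k)%N)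
    (hlie : lie_bracket mu)
    (hnull : in_null_cone p (p + k)%N mu) :
  exists U : {vspace V},
    [/\ subalgebra mu U, nilpotent_alg mu U & \dim U = (p + k)%N].
Proof.
have [g [g_nd [e e_basis ge] [_ _ orbit0]]] := hnull.
set n := (p + (p + k))%N in e e_basis ge.
have [M [d [MM [d_gt0 d_card] weight]]] : exists (M : 'M[R]_n) (d : 'rV[R]_n),
    [/\ M *m M^T = 1%:M,
       (forall i, 0 < d 0 i) /\ (#|[set i | (d 0 i < 1)%R]| <= p)%N &
       forall i j l, structure_coef (basis_coef e mu) M i j l != 0 ->
         d 0 i * d 0 j < d 0 l].
  (* Positivity and the count of [d i < 1] form the predicate [P], so both are inherited by the
     frame obtained. *)
  apply: degenerating_frame => [d []//|eps eps_gt0].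
  (* A structure constant in a new frame is a sum of [n ^ 3] terms of size at most [eps']; the
     successor keeps the denominator positive. *)
  pose eps' := eps / (n ^ 3).+1%:R.
  have eps'_gt0 : 0 < eps' by rewrite divr_gt0.
  pose f (abl : 'I_n * 'I_n * 'I_n) (w : 'Hom(V, 'Hom(V, V))) :=
    basis_coef e w abl.1.1 abl.1.2 abl.2.
  have f_lin abl : scalar (f abl).
    by move=> c w1 w2; rewrite /f /basis_coef !(add_lfunE, scale_lfunE) linearP.
  have [_ [A gA <-] small] := vect_closure0_small f_lin orbit0 eps'_gt0.
  have [M [N [d [MM NN NA d_gt0 d_card]]]] :=
    pseudo_orthogonal_svd (isometry_signature_mx e_basis ge gA).
  exists M, d; split=> // i j l.
  rewrite (structure_coef_act _ i j l e_basis (isometry_lker0 g_nd gA) MM NN NA).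
  rewrite normrM (gtr0_norm (d_gt0 l)) ler_pM2r //.
  have := structure_coef_le i j l NN (fun a b c => small (a, b, c)).
  move=> /le_trans; apply.
  rewrite -(mulr_natr eps') /eps' -mulrA ler_piMr ?ltW // mulrC ltr_pdivrMr ?mul1r //.
  by rewrite ltr_nat.
apply: (@nilpotent_subalgebra_of_weights _ _ _ n (frame e M) (d 0)) => //.
- exact: frame_basis.
- by move=> i j l; rewrite -structure_coefE //; exact: weight.
(* Of the [p + (p + k)] weights at most [p] are below 1, so at least [p + k] are at least 1. *)
have := cardsC [set i | (d 0 i < 1)%R]; rewrite card_ord => cardE.
rewrite (_ : [set i | (1 <= d 0 i)%R] = ~: [set i | (d 0 i < 1)%R]).
  by rewrite -(leq_add2l p) (leq_trans (eq_leq (esym cardE))) ?leq_add2r.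
by apply/setP => i; rewrite !inE -leNgt.
Qed.
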